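(* For every finite simple graph $G$ with maximal simplex dimension $r$, the squared analytic torsion $A(G)=\prod_{k=0}^{r}\mathrm{Det}(L_k)^{k(-1)^{k+1}}$ satisfies $$A(G)=\mathrm{SDet}(D)=\prod_{k=0}^{r}\mathrm{Det}(D_k)^{(-1)^{k}},$$ where $D_k=d_k^*d_k$ are the Dirac blocks.
   Context: Let $G=(V,E)$ be a finite simple graph. A $k$-simplex of $G$ is (the vertex set of) a complete subgraph $K_{k+1}$; $f_k$ is the number of $k$-simplices, and $r$ is the maximal dimension of a simplex. Order the vertices; for a $(k+1)$-simplex $x=\{v_0<\dots<v_{k+1}\}$ and $y=x\setminus\{v_i\}$ put $\mathrm{sign}(y,x)=(-1)^i$. The exterior derivative $d_k$ is the $f_{k+1}\times f_k$ matrix given by $d_kf(x)=\sum_{y\subset x,\ \dim y=k}\mathrm{sign}(y,x)f(y)$ (with $d_{-1}=0$, $d_r=0$). These assemble to a matrix $d$ on the space of functions on all simplices; $D=d+d^*$ is the Dirac operator and $L=D^2$ the Hodge Laplacian, with diagonal blocks $L_k=d_k^*d_k+d_{k-1}d_{k-1}^*$. The Dirac blocks are $D_k=d_k^*d_k$. The pseudo determinant $\mathrm{Det}(M)$ of a square matrix $M$ is the product of its non-zero eigenvalues, counted with multiplicity (equal to $1$ if there are none). The super pseudo determinant of $D$ is by definition $\mathrm{SDet}(D)=\prod_k\mathrm{Det}(D_k)^{(-1)^k}$. *)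

(* Defs.v *)
From HB Require Import structures.
From mathcomp Require Import all_boot all_order all_algebra.
From mathcomp Require Import sesquilinear spectral.

Set Implicit Arguments.
Unset Strict Implicit.
Unset Printing Implicit Defensive.

Import Order.TTheory GRing.Theory Num.Theory.
Local Open Scope ring_scope.
Local Open Scope sesquilinear_scope.

(* The [sval] is the list of roots of [char_poly M], each repeated according to
   its multiplicity. *)
Definition eigenvalues (C : numClosedFieldType) (n : nat) (M : 'M[C]_n) :
    seq C :=
  sval (closed_field_poly_normal (char_poly M)).

Definition pdet (C : numClosedFieldType) (n : nat) (M : 'M[C]_n) : C :=
  \prod_(a <- eigenvalues M | a != 0) a.

Section CliqueComplex.

(* The order of the vertices used for the signs is that of the type [T]. *)
Variables (disp : Order.disp_t) (T : finOrderType disp) (e : rel T).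

Definition clique (x : {set T}) : bool :=
  [forall v in x, forall w in x, (v != w) ==> e v w].

Definition simplices (k : nat) : {set {set T}} :=
  [set x | clique x && (#|x| == k.+1)].

Definition nsimp (k : nat) : nat := #|simplices k|.

(* For the graph without vertices this is 0 rather than -1; all the spaces of
   functions on simplices are then zero. *)
Definition max_dim : nat := (\max_(x : {set T} | clique x) #|x|).-1.

Variable C : numClosedFieldType.

(* If y = x :\ v, the exponent is the position of v in x listed increasingly,
   counted from 0. Only used when y is a facet of x. *)
Definition face_sign (y x : {set T}) : C :=
  if [pick v in x :\: y] is Some v
  then (-1) ^+ #|[set w in x | (w < v)%O]| else 0.

(* Functions on k-simplices are column vectors, so d_k f is [ext_deriv k *m f].
   When k = max_dim there are no rows, which is the convention d_r = 0. *)
Definition ext_deriv (k : nat) : 'M[C]_(nsimp k.+1, nsimp k) :=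
  \matrix_(i, j)
    let x : {set T} := enum_val i in
    let y : {set T} := enum_val j in
    if y \subset x then face_sign y x else 0.

Definition dirac_block (k : nat) : 'M[C]_(nsimp k) :=
  (ext_deriv k) ^t* *m ext_deriv k.

(* In the case k = 0 the second summand vanishes, since d_{-1} = 0. *)
Definition laplacian_block (k : nat) : 'M[C]_(nsimp k) :=
  match k return 'M[C]_(nsimp k) with
  | 0 => dirac_block 0
  | j.+1 => dirac_block j.+1 + ext_deriv j *m (ext_deriv j) ^t*
  end.

Definition analytic_torsion : C :=
  \prod_(k < max_dim.+1)
    pdet (laplacian_block k) ^ (k%:Z * (-1) ^+ k.+1).

Definition super_pdet : C :=
  \prod_(k < max_dim.+1) pdet (dirac_block k) ^ ((-1) ^+ k : int).

End CliqueComplex.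

(* Main.v *)
Require Import Defs.
From HB Require Import structures.
From mathcomp Require Import all_boot all_order all_algebra.
From mathcomp Require Import ring.

Set Implicit Arguments.
Unset Strict Implicit.
Unset Printing Implicit Defensive.

(** If AB = 0 then (X - A)(X - B) = X (X - (A + B)), so the characteristic
    polynomials of A, B and A + B agree up to a power of X and
    Det(A + B) = Det(A) Det(B). Since d_(k+1) d_k = 0, this applies to the two
    summands of L_(k+1). As Det(AB) = Det(BA) even for rectangular matrices,
    Det(L_(k+1)) = Det(D_(k+1)) Det(D_k), and the product defining the torsion
    telescopes. *)

Import Order.TTheory GRing.Theory Num.Theory.
Local Open Scope ring_scope.

(** * Characteristic polynomials and pseudo determinants *)

Lemma char_poly_mulmxC (R : comNzRingType) (m n : nat)
    (A : 'M[R]_(m, n)) (B : 'M[R]_(n, m)) :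
  char_poly (A *m B) * 'X^n = char_poly (B *m A) * 'X^m.
Proof.
pose a := map_mx polyC A; pose b := map_mx polyC B.
(* M is triangularized by a unimodular factor on the right, and by one of
   determinant X^n on the left. *)
pose M : 'M[{poly R}]_(m + n) := block_mx 'X%:M a b 1%:M.
have detMl : \det M = char_poly (A *m B).
  have <- : \det (M *m block_mx 1%:M 0 (- b) 1%:M) = char_poly (A *m B).
    rewrite mulmx_block !mulmx1 !mulmx0 !add0r mul1mx subrr det_ublock det1.
    by rewrite mulr1 mulmxN -map_mxM.
  by rewrite det_mulmx det_lblock !det1 !mulr1.
have detMr : 'X^n * \det M = char_poly (B *m A) * 'X^m.
  rewrite -['X^n]mul1r -(det1 _ m) -(det_scalar n 'X) -(det_lblock _ (- b)).
  rewrite -det_mulmx mulmx_block !mul1mx !mul0mx !addr0 mulmx1.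
  rewrite -scalar_mxC mulNmx addNr det_ublock det_scalar mulrC; congr (_ * _).
  by rewrite mulNmx addrC -map_mxM.
by rewrite -detMl mulrC.
Qed.

Lemma char_polyD (R : comNzRingType) (n : nat) (A B : 'M[R]_n) :
  A *m B = 0 -> char_poly A * char_poly B = char_poly (A + B) * 'X^n.
Proof.
move=> AB0; rewrite -(det_scalar n 'X) -!det_mulmx /char_poly_mx map_mxD.
rewrite mulmxBl !mulmxBr -map_mxM AB0 map_mx0 subr0.
by rewrite mulmxBl mulmxDl opprD addrA addrAC (scalar_mxC _ (map_mx _ B)).
Qed.

Section PseudoDeterminant.

Variable C : numClosedFieldType.

Lemma char_poly_eigenvalues (n : nat) (M : 'M[C]_n) :
  char_poly M = \prod_(a <- eigenvalues M) ('X - a%:P).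
Proof.
rewrite /eigenvalues; case: closed_field_poly_normal => s /= {1}->.
by rewrite (monicP (char_poly_monic M)) scale1r.
Qed.

(* The factors X account for zero eigenvalues, which do not matter in pdet. *)
Lemma pdetE (n a b : nat) (M : 'M[C]_n) (s : seq C) :
  char_poly M * 'X^a = \prod_(x <- s) ('X - x%:P) * 'X^b ->
  pdet M = \prod_(x <- s | x != 0) x.
Proof.
have Xn j : 'X^j = \prod_(x <- nseq j (0 : C)) ('X - x%:P).
  by rewrite big_nseq -Monoid.iteropE /= subr0.
have nz j : \prod_(x <- nseq j (0 : C) | x != 0) x = 1.
  by rewrite big1_seq // => x /andP[+ /nseqP[x0 _]]; rewrite x0 eqxx.
(* A product of monic linear factors determines its roots up to permutation, so the two lists,
   padded with zeros, are permutations of each other. *)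
rewrite char_poly_eigenvalues !Xn -!big_cat => /prod_XsubC_eq pm.
rewrite /pdet -[LHS]mulr1 -[X in _ * X = _](nz a) -big_cat (perm_big _ pm) /=.
by rewrite big_cat nz /= mulr1.
Qed.

Lemma pdet_neq0 (n : nat) (M : 'M[C]_n) : pdet M != 0.
Proof. by rewrite prodf_seq_neq0; apply/allP => x _; apply/implyP. Qed.

Lemma pdet0 (n : nat) : pdet (0 : 'M[C]_n) = 1.
Proof.
rewrite (@pdetE n 0 n _ [::]) ?big_nil // mulr1 mul1r.
by rewrite /char_poly /char_poly_mx map_mx0 subr0 det_scalar.
Qed.

Lemma pdet_mulmxC (m n : nat) (A : 'M[C]_(m, n)) (B : 'M[C]_(n, m)) :
  pdet (A *m B) = pdet (B *m A).
Proof.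
by apply: (@pdetE m n m); rewrite char_poly_mulmxC char_poly_eigenvalues.
Qed.

Lemma pdetD (n : nat) (A B : 'M[C]_n) :
  A *m B = 0 -> pdet (A + B) = pdet A * pdet B.
Proof.
move=> /char_polyD AB.
rewrite (@pdetE n n 0 _ (eigenvalues A ++ eigenvalues B)) ?big_cat //=.
by rewrite -!char_poly_eigenvalues -AB mulr1.
Qed.

End PseudoDeterminant.

(** * The clique complex *)

Section CliqueComplex.

Variables (disp : Order.disp_t) (T : finOrderType disp) (e : rel T).
Variable C : numClosedFieldType.

Lemma clique_subset (x y : {set T}) : y \subset x -> clique e x -> clique e y.
Proof.
move=> /subsetP yx /forall_inP cx; apply/forall_inP => v vy.
by apply/forall_inP => w wy; apply: (forall_inP (cx v (yx v vy))); apply: yx.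
Qed.

Lemma face_sign_setD1 (x : {set T}) (v : T) :
  v \in x -> face_sign C (x :\ v) x = (-1) ^+ #|[set w in x | (w < v)%O]|.
Proof.
move=> vx; rewrite /face_sign; case: pickP => [u | /(_ v)].
  by rewrite !inE negb_and negbK andbC => /andP[ux]; rewrite ux orbF => /eqP->.
by rewrite !inE eqxx vx.
Qed.

(** Deleting [b] leaves the position of the smaller [a] unchanged, whereas deleting [a] lowers the
    position of [b] by one: the two orders of deletion differ by one sign. *)
Lemma face_sign_setD1_lt (x : {set T}) (a b : T) :
    a \in x -> b \in x -> (a < b)%O ->
  face_sign C (x :\ a) x * face_sign C (x :\ a :\ b) (x :\ a) =
    - (face_sign C (x :\ b) x * face_sign C (x :\ b :\ a) (x :\ b)).
Proof.
move=> ax bx ab; have ne_ab := lt_eqF ab.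
rewrite !face_sign_setD1 ?inE ?ax ?bx ?ne_ab ?(eq_sym b) ?ne_ab //.
have -> : [set w in x :\ b | (w < a)%O] = [set w in x | (w < a)%O].
  apply/setP => w; rewrite !inE; case: eqVneq => // ->.
  by rewrite (lt_gtF ab) !andbF.
rewrite [in RHS](cardsD1 a) !inE ax ab.
have -> : [set w in x :\ a | (w < b)%O] = [set w in x | (w < b)%O] :\ a.
  by apply/setP => w; rewrite !inE andbA.
by rewrite exprS mulN1r mulNr opprK mulrC.
Qed.

(** In the entry at (x, z) with z inside x, the difference of x and z is a pair {a, b}. Only the
    faces x - a and x - b lie between z and x, and their contributions cancel. *)
Lemma ext_deriv_mul0 (k : nat) :
  ext_deriv e C k.+1 *m ext_deriv e C k = 0.
Proof.
apply/matrixP => i j; rewrite !mxE.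
set x : {set T} := enum_val i; set z : {set T} := enum_val j.
have /[!inE] /andP[cx /eqP sx] : x \in simplices e k.+2 by apply: enum_valP.
have /[!inE] /andP[cz /eqP sz] : z \in simplices e k by apply: enum_valP.
pose F (y : {set T}) : C := (if y \subset x then face_sign C y x else 0) *
  (if z \subset y then face_sign C z y else 0).
transitivity (\sum_(y in simplices e k.+1) F y).
  by rewrite [RHS]big_enum_val; apply: eq_bigr => l _; rewrite !mxE.
have [zx | nzx] := boolP (z \subset x); last first.
  apply: big1 => y _; rewrite /F; case: ifP => yx; last by rewrite mul0r.
  by rewrite ifN ?mulr0 //; apply: contra nzx => /subset_trans; apply.
(* The two missing vertices may be named so that [a] is the smaller. *)
suff two (a b : T) : x :\: z = [set a; b] -> (a < b)%O ->
    \sum_(y in simplices e k.+1) F y = 0.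
  have /cards2P[a [b [ne_ab xz]]] : #|x :\: z| == 2.
    by rewrite cardsD (setIidPr zx) sx sz -addn2 addnC addnK.
  have [ab | ba | /eqP] := ltgtP a b; first exact: two xz ab.
    by rewrite setUC in xz; apply: two xz ba.
  by rewrite (negbTE ne_ab).
move=> xz ab.
have ne_ab := lt_eqF ab.
have /[!inE] /andP[az ax] : a \in x :\: z by rewrite xz !inE eqxx.
have /[!inE] /andP[bz bx] : b \in x :\: z by rewrite xz !inE eqxx orbT.
have zE : z = x :\ a :\ b.
  by rewrite setDDl -xz setDDr setDv set0U (setIidPr zx).
have face v : v \in x -> x :\ v \in simplices e k.+1.
  move=> vx; rewrite inE (clique_subset _ cx) ?subsetDl //=.
  by move: sx; rewrite (cardsD1 v) vx add1n => -[->].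
rewrite (bigD1 (x :\ a)) ?face //= (bigD1 (x :\ b)) /=; last first.
  rewrite face //=; apply/eqP => /setP/(_ a).
  by rewrite !inE eqxx ax ne_ab.
rewrite big1 ?addr0 => [|y].
  have zE' : z = x :\ b :\ a by rewrite zE setDDl setUC -setDDl.
  have Fa : F (x :\ a) = face_sign C (x :\ a) x *
      face_sign C (x :\ a :\ b) (x :\ a) by rewrite /F zE !subsetDl.
  have Fb : F (x :\ b) = face_sign C (x :\ b) x *
      face_sign C (x :\ b :\ a) (x :\ b) by rewrite /F zE' !subsetDl.
  by rewrite Fa Fb face_sign_setD1_lt // addNr.
(* Any other y with a nonzero term would contain [a], [b] and z, hence all of x, which has one
   vertex too many. *)
rewrite inE -andbA => /andP[/andP[_ /eqP sy] /andP[ya yb]]; rewrite /F.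
case: ifP => yx; last by rewrite mul0r.
case: ifP => zy; last by rewrite mulr0.
have mem v : v \in x -> y != x :\ v -> v \in y.
  move=> vx; apply: contraNT => vy; rewrite eqEcard subsetD1 yx vy /=.
  by move: (face v vx); rewrite inE sy => /andP[_ /eqP->].
suff /subset_leq_card : x \subset y by rewrite sx sy ltnn.
rewrite -(setID x z) xz (setIidPr zx) subUset zy subUset !sub1set.
by rewrite !mem.
Qed.

Lemma pdet_laplacian_blockS (k : nat) :
  pdet (laplacian_block e C k.+1) =
    pdet (dirac_block e C k.+1) * pdet (dirac_block e C k).
Proof.
rewrite /= pdetD; last first.
  rewrite /dirac_block -!mulmxA (mulmxA _ (ext_deriv e C k)) ext_deriv_mul0.
  by rewrite mul0mx mulmx0.
by congr (_ * _); rewrite pdet_mulmxC.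
Qed.

(** There are no simplices above the top dimension, so each entry is an empty sum. The bound
    [leqSpred] also covers the graph without vertices. *)
Lemma dirac_block_max_dim : dirac_block e C (max_dim e) = 0.
Proof.
apply/matrixP => i j; rewrite !mxE big1 // => l _.
have /[!inE] /andP[cx /eqP sx] := enum_valP l.
have := @leq_bigmax_cond _ (clique e) (fun x : {set T} => #|x|) _ cx.
by rewrite sx ltnNge leqSpred.
Qed.

End CliqueComplex.

(** For k < n, [D k] gets exponent k(-1)^(k+1) from [L k] and (k+1)(-1)^k from [L k.+1], in total
    (-1)^k. The last factor corrects for the absent [L n.+1]. *)
Lemma prod_alternating_telescope (F : fieldType) (L D : nat -> F) (n : nat) :
    (forall k, D k != 0) -> (forall k, L k.+1 = D k.+1 * D k) ->
  \prod_(k < n.+1) L k ^ (k%:Z * (-1) ^+ k.+1) =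
    (\prod_(k < n.+1) D k ^ ((-1) ^+ k : int)) *
    D n ^ (n.+1%:Z * (-1) ^+ n.+1).
Proof.
move=> D0 LD; elim: n => [|n IHn].
  by rewrite !big_ord1 mul0r expr0z -expfzDr.
rewrite big_ord_recr IHn [in RHS]big_ord_recr /= LD expfzMl.
rewrite -!mulrA; congr (_ * _); rewrite mulrCA.
rewrite -!expfzDr //.
(* The power of [D n] coming from [L n.+1] cancels the correction factor of the induction
   hypothesis. *)
have -> : n.+1%:Z * (-1) ^+ n.+1 + n.+1%:Z * (-1) ^+ n.+2 = 0.
  by rewrite (exprS _ n.+1); ring.
rewrite expr0z mulr1; congr (_ ^ _).
by rewrite !exprS [n.+2%:Z]intS; ring.
Qed.

Theorem mainTheorem2 (C : numClosedFieldType) (disp : Order.disp_t)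
    (T : finOrderType disp) (e : rel T)
    (e_sym : symmetric e) (e_irr : irreflexive e) :
  analytic_torsion e C = super_pdet e C /\
  super_pdet e C =
    \prod_(k < (max_dim e).+1) pdet (dirac_block e C k) ^ ((-1) ^+ k : int).
Proof.
split=> //; rewrite /analytic_torsion.
rewrite (prod_alternating_telescope _
  (L := fun k => pdet (laplacian_block e C k))
  (D := fun k => pdet (dirac_block e C k))) => [|k|k].
(* The correction factor is a power of the pseudo determinant of a zero matrix, which is 1. *)
- by rewrite dirac_block_max_dim pdet0 exp1rz mulr1.
- exact: pdet_neq0.
- exact: pdet_laplacian_blockS.
Qed.
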